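(* Let $n\ge 1$ be an integer. The number of $2n$-trimmed Dyck words is $C_{n+1}-1$, where $C_m=\frac{1}{m+1}\binom{2m}{m}$ denotes the $m$-th Catalan number.
   Context: An extended Dyck word of length $2n$ is a word with $n$ letters $0$ and $n$ letters $1$ such that every nonempty proper initial segment has strictly more $0$s than $1$s. A $2n$-trimmed Dyck word is a word obtained from an extended Dyck word of length $2n$ by replacing some (possibly none) of its disjoint contiguous substrings of the form $\epsilon\epsilon\cdots\epsilon$ ($k$ letters, $\epsilon\in\{0,1\}$, $k\ge 2$) by $\epsilon\epsilon\cdots\epsilon$ ($k'$ letters) with $0<k'<k$. For example, for $n=3$ the $6$-trimmed Dyck words are $0111, 00111, 000111, 011, 0011, 00011, 01, 001, 0001, 001011, 01011, 00101, 0101$. *)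

(* Defs.v *)
From mathcomp Require Import all_boot.

Set Implicit Arguments.
Unset Strict Implicit.
Unset Printing Implicit Defensive.

(* Words over {0, 1} are sequences of booleans, with false for the letter 0
   and true for the letter 1. *)
Definition word := seq bool.

Definition extended_dyck (n : nat) (w : word) : Prop :=
  [/\ count_mem false w = n,
      count_mem true w = n &
      forall u v : word, w = u ++ v -> u <> [::] -> v <> [::] ->
        count_mem true u < count_mem false u].

(* [trims w w'] reads w from left to right: each step either keeps one letter
   or consumes one of the selected constant substrings (of k >= 2 equal letters,
   not necessarily a maximal run) and outputs its shortened version.  The
   selected substrings are therefore disjoint factors of the original word w,
   replaced simultaneously. *)
Inductive trims : word -> word -> Prop :=
| trims_nil : trims [::] [::]
| trims_keep (e : bool) (w w' : word) :
    trims w w' -> trims (e :: w) (e :: w')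
| trims_replace (e : bool) (k k' : nat) (w w' : word) :
    2 <= k -> 0 < k' < k -> trims w w' ->
    trims (nseq k e ++ w) (nseq k' e ++ w').

Definition trimmed_dyck (n : nat) (w' : word) : Prop :=
  exists2 w : word, extended_dyck n w & trims w w'.

Definition catalan (m : nat) : nat := 'C(m.*2, m) %/ m.+1.

(* The division in [catalan] is exact. *)
Lemma catalanE (m : nat) : catalan m * m.+1 = 'C(m.*2, m).
Proof.
apply: divnK; rewrite -(Gauss_dvdr _ (coprimeSn m)).
have := mul_bin_left m.*2 m.
by rewrite -addnn addnK => <-; apply: dvdn_mulr.
Qed.

(* Main.v *)
(* Only the first run of 0s and the last run of 1s need ever be stretched, so the
   trimmed words for n = m + 1 are the words 0 v 1 such that, at every cut
   v = p s, the number of 1s in p plus the number of 0s in s is at most m.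
   If v has x zeros and y ones, this says that x, y <= m and that the lattice path
   of v (0 up, 1 down), started at height m - x, never goes below 0.  By reflection
   there are 'C(x + y, x) - 'C(x + y, m + 1) such paths.  Summing over x, y <= m
   with the hockey-stick identity gives
   ('C(2n, n) - 1) - 'C(2n, n + 2), that is, the Catalan number of n + 1 minus 1. *)
Require Import Defs.
From mathcomp Require Import all_boot.
From mathcomp Require Import classical_sets cardinality.
From mathcomp Require Import zify.

Local Open Scope classical_set_scope.
Local Open Scope card_scope.

(* [lia] abstracts counts up to syntax, so it would tell apart the two convertible
   presentations of the letter type. *)
Ltac lia_count :=
  change (Equality.sort Datatypes_bool__canonical__eqtype_Equality) with bool in *;
  lia.

(** * Trimming: closure properties, cuts and letter counts *)

Lemma trims_refl (w : word) : trims w w.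
Proof. by elim: w => [|e w IHw]; constructor. Qed.

Lemma trims_cat {u u' w w' : word} :
  trims u u' -> trims w w' -> trims (u ++ w) (u' ++ w').
Proof.
move=> tu tw; elim: tu => // [e v v' _ IHv | e k k' v v' k_gt1 k'k _ IHv].
  exact: trims_keep.
by rewrite -!catA; apply: trims_replace.
Qed.

Lemma trims_nseq (e : bool) (k k' : nat) :
  0 < k' <= k -> trims (nseq k e) (nseq k' e).
Proof.
case/andP=> k'_gt0; rewrite leq_eqVlt => /predU1P[-> | k'k].
  exact: trims_refl.
rewrite -(cats0 (nseq k e)) -(cats0 (nseq k' e)).
by apply: trims_replace; [lia | rewrite k'_gt0 | constructor].
Qed.

Lemma cat_eq_cat {T : Type} {u v p s : seq T} :
  u ++ v = p ++ s ->
  (exists t, u = p ++ t /\ s = t ++ v) \/ (exists t, p = u ++ t /\ v = t ++ s).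
Proof.
elim: u p => [|a u IHu] [|b p] /=.
- by move=> ->; left; exists [::].
- by move=> ->; right; exists (b :: p).
- by move=> <-; left; exists (a :: u).
- by case=> -> /IHu[] [t [-> ->]]; [left | right]; exists t.
Qed.

Lemma nseq_eq_cat {k : nat} {a : bool} {p t : word} :
  nseq k a = p ++ t -> p = nseq (size p) a /\ t = nseq (size t) a.
Proof.
move=> Dk; have := all_pred1_nseq a k.
by rewrite Dk all_cat => /andP[/all_pred1P ? /all_pred1P].
Qed.

(* A cut inside a shortened run lifts to a cut inside the original run, because
   the run can be shared out so that each part is at least as long. *)
Lemma trims_split {w p s : word} :
  trims w (p ++ s) ->
  exists u v : word, [/\ w = u ++ v, trims u p & trims v s].
Proof.
move Dw': (p ++ s) => w' tw.
elim: tw p s Dw' => {w w'} [|e w w' tw IHw|e k k' w w' k_gt1 k'k tw IHw] p s.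
- by case: p => //= ->; exists [::], [::]; split; constructor.
- case: p => [|e1 p] /= => [-> | [-> /IHw[u [v [-> tu tv]]]]].
    by exists [::], (e :: w); split=> //; constructor.
  by exists (e :: u), v; split=> //; constructor.
- case: (posnP (size p)) => [/size0nil-> /= -> | p_gt0].
    by exists [::], (nseq k e ++ w); split=> //; constructor.
  move/esym/cat_eq_cat=> [[t [Dp ->]] | [t [-> /esym/IHw[u [v [-> tu tv]]]]]].
    have k'E : size p + size t = k' by rewrite -size_cat -Dp size_nseq.
    have [-> ->] := nseq_eq_cat Dp.
    (* All surplus letters of the run go to the left share, which is nonempty because [p] is; the
       right share keeps its length. *)
    exists (nseq (k - size t) e), (nseq (size t) e ++ w); split.
    + by rewrite catA -nseqD subnK //; lia.
    + by apply: trims_nseq; lia.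
    + by apply: trims_cat tw; apply: trims_refl.
  exists (nseq k e ++ u), v; split; rewrite ?catA //.
  by apply: trims_cat tu; apply: trims_nseq; lia.
Qed.

Lemma trims_count (b : bool) {w w' : word} :
  trims w w' -> count_mem b w' <= count_mem b w.
Proof.
elim=> //= [e v v' _ | e k k' v v' _ k'k _]; rewrite ?count_cat ?count_nseq.
  by rewrite leq_add2l.
by move=> le_v; apply: leq_add le_v; case: pred1 => /=; lia_count.
Qed.

(** Since [k] and [k'] are both positive, no letter disappears altogether. This later forces the
    first letter to be 0 and the last to be 1. *)
Lemma trims_count_eq0 (b : bool) {w w' : word} :
  trims w w' -> (count_mem b w' == 0) = (count_mem b w == 0).
Proof.
elim=> //= [e v v' _ IHv | e k k' v v' k_gt1 k'k _ IHv].
  by rewrite !addn_eq0 IHv.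
have [k0 k'0] : k != 0 /\ k' != 0 by split; lia_count.
by rewrite !count_cat !count_nseq !addn_eq0 !muln_eq0 IHv (negPf k0) (negPf k'0).
Qed.

(** * Trimmed Dyck words characterised by their cuts *)

Definition low_cuts (m : nat) (v : word) : Prop :=
  forall p s : word, v = p ++ s -> count_mem true p + count_mem false s <= m.

Lemma count_bool (w : word) : count_mem false w + count_mem true w = size w.
Proof. by elim: w => //= -[] w; lia_count. Qed.

(** A cut of [w] lifts to a cut [u ++ v] of the Dyck word. As that word has [n.+1] zeros, strict
    domination bounds the 1s of [u] plus the 0s of [v] by [n], and trimming only lowers these
    counts. *)
Lemma trimmed_dyck_low_cuts {n : nat} {w : word} :
  trimmed_dyck n.+1 w ->
  exists2 v : word, w = false :: rcons v true & low_cuts n v.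
Proof.
case=> d [d0 d1 dyck_d] tw.
have cut p s : p <> [::] -> s <> [::] -> w = p ++ s ->
    count_mem true p + count_mem false s <= n.
  move=> p_n0 s_n0 Dw; move: tw; rewrite Dw.
  case/trims_split=> u [v [Dd tu tv]].
  have u_n0 : u <> [::].
    move=> u0; apply: p_n0; apply/size0nil; rewrite -count_bool.
    have := trims_count false tu; have := trims_count true tu.
    by rewrite u0 /=; lia_count.
  have v_n0 : v <> [::].
    move=> v0; apply: s_n0; apply/size0nil; rewrite -count_bool.
    have := trims_count false tv; have := trims_count true tv.
    by rewrite v0 /=; lia_count.
  have := dyck_d u v Dd u_n0 v_n0.
  have := trims_count true tu; have := trims_count false tv.
  by move: d0; rewrite Dd count_cat; lia_count.
have w0 : count_mem false w != 0 by rewrite (trims_count_eq0 false tw) d0.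
have w1 : count_mem true w != 0 by rewrite (trims_count_eq0 true tw) d1.
case: w => [|e w] // in tw cut w0 w1 *.
(* Were the first letter 1, its preimage would be a nonempty proper prefix of [d] without 0s. *)
have e0 : e = false.
  case: e => // in tw w1 w0 cut *.
  case/(@trims_split d [:: true]): tw => u [v [Dd tu tv]].
  have u0 : count_mem false u = 0.
    by apply/eqP; rewrite -(trims_count_eq0 false tu).
  have v_n0 : v <> [::].
    by move=> v0; move: d0; rewrite Dd v0 cats0 u0.
  have u_n0 : u <> [::].
    by move=> un; have := trims_count true tu; rewrite un.
  by have := dyck_d u v Dd u_n0 v_n0; rewrite u0.
case/lastP: w => [|v e'] in e0 tw cut w0 w1 *; first by rewrite e0 in w1.
exists v; last first.
  (* The frame letters make both sides nonempty, as [cut] requires, and cannot lower either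
     count. *)
  move=> p s Dv; have := cut (e :: p) (rcons s e').
  rewrite Dv rcons_cat e0 => /(_ _ _ erefl).
  rewrite -cats1 count_cat => le_n; apply: leq_trans (le_n _ _) => //.
    by rewrite /= add0n leq_add2l leq_addr.
  by case: (s).
rewrite e0; congr (_ :: rcons _ _).
(* Were the last letter 0, its preimage would have no 1s, so the prefix before it would contain all
   [n.+1] of them. *)
case: e' => // in tw cut w0 w1 *.
move: tw; rewrite -cats1 -cat_cons.
case/trims_split=> u [s [Dd tu ts]].
have s1 : count_mem true s = 0.
  by apply/eqP; rewrite -(trims_count_eq0 true ts).
have u_n0 : u <> [::] by move=> u0; move: d1; rewrite Dd u0 /= s1.
have s_n0 : s <> [::].
  by move=> sn; have := trims_count false ts; rewrite sn.
have := dyck_d u s Dd u_n0 s_n0.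
by move: d0 d1; rewrite Dd !count_cat s1; lia_count.
Qed.

Lemma low_cuts_trimmed_dyck {n : nat} {v : word} :
  low_cuts n v -> trimmed_dyck n.+1 (false :: rcons v true).
Proof.
move=> low; have := low v [::]; have := low [::] v erefl.
rewrite cats0 /= add0n addn0 => c0_le /(_ erefl) c1_le.
(* The two frame letters are stretched to runs of lengths [a] and [b], which bring each letter count
   to [n.+1]; both are positive by the two extreme cuts. *)
have [a aE] : exists a, a + count_mem false v = n.+1.
  by exists (n.+1 - count_mem false v); rewrite subnK //; apply: leqW.
have [b bE] : exists b, count_mem true v + b = n.+1.
  by exists (n.+1 - count_mem true v); rewrite subnKC //; apply: leqW.
exists (nseq a false ++ v ++ nseq b true); last first.
  rewrite -cats1; apply: (@trims_cat _ [:: false] _ (v ++ [:: true])).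
    by apply: (@trims_nseq _ _ 1); lia_count.
  apply: trims_cat; first exact: trims_refl.
  by apply: (@trims_nseq _ _ 1); lia_count.
split; first by rewrite !count_cat !count_nseq /=; lia_count.
  by rewrite !count_cat !count_nseq /=; lia_count.
move=> p s /cat_eq_cat[[t [Dp _]] | [t [-> Dt]]] p_n0 s_n0.
  have [-> _] := nseq_eq_cat Dp; rewrite !count_nseq /=.
  by case: p p_n0 {Dp}.
rewrite !count_cat !count_nseq /=.
case/cat_eq_cat: Dt => [[v' [Dv _]] | [u [-> Du]]].
  (* For a cut inside [v] the bound is strict domination itself, because [a] plus the 0s of [v] is
     [n.+1]. *)
  have := low _ _ Dv; rewrite Dv count_cat in aE *.
  by lia_count.
(* A cut in the final run leaves all [n.+1] zeros on its left and at least one 1 on its right. *)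
have [-> Ds] := nseq_eq_cat Du; rewrite !count_cat !count_nseq /=.
have ub : size u + size s = b by rewrite -size_cat -Du size_nseq.
have s_gt0 : 0 < size s by case: (s) s_n0.
by lia_count.
Qed.

(** * Lattice paths that stay nonnegative *)

Fixpoint nonneg_from (i : nat) (w : word) : bool :=
  match w with
  | [::] => true
  | false :: w' => nonneg_from i.+1 w'
  | true :: w' => (0 < i) && nonneg_from i.-1 w'
  end.

Lemma nonneg_fromP (i : nat) (w : word) :
  reflect (forall p s : word, w = p ++ s ->
             count_mem true p <= i + count_mem false p)
          (nonneg_from i w).
Proof.
elim: w i => [|[] w IHw] i /=.
- by left; case.
- apply: (iffP andP) => [[i_gt0 /IHw nn] [|b p] s //= [<- Dw] | nn].
    by have := nn p s Dw => /=; lia_count.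
  have i_gt0 : 0 < i by have := nn [:: true] w erefl => /=; lia_count.
  split=> //; apply/IHw=> p s Dw.
  by have := nn (true :: p) s; rewrite Dw => /(_ erefl) /=; lia_count.
- apply: (iffP (IHw _)) => [nn [|b p] s //= [<- Dw] | nn p s Dw].
    by have := nn p s Dw => /=; lia_count.
  by have := nn (false :: p) s; rewrite Dw => /(_ erefl) /=; lia_count.
Qed.

(** The 0s of [s] are those of [v] minus those of [p], which turns the cut bound into a height
    bound. *)
Lemma low_cutsP (m : nat) (v : word) :
  reflect (low_cuts m v)
    [&& count_mem false v <= m, count_mem true v <= m
      & nonneg_from (m - count_mem false v) v].
Proof.
apply: (iffP and3P) => [[c0 _ /nonneg_fromP nn] p s Dv | low].
  by have := nn p s Dv; move: c0; rewrite Dv count_cat; lia_count.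
have := low v [::]; have := low [::] v erefl.
rewrite cats0 /= add0n addn0 => c0 /(_ erefl) c1; split=> //.
apply/nonneg_fromP => p s Dv.
by have := low p s Dv; move: c0; rewrite Dv count_cat; lia_count.
Qed.

(** Here [k] counts the remaining steps, [x] the remaining up steps, and [i] is the current
    height. *)
Fixpoint nonneg_paths (k x i : nat) : seq (seq bool) :=
  match k with
  | 0 => if x == 0 then [:: [::]] else [::]
  | k'.+1 =>
      (if x is x'.+1 then map (cons false) (nonneg_paths k' x' i.+1) else [::])
      ++ (if i is i'.+1 then map (cons true) (nonneg_paths k' x i') else [::])
  end.

Lemma mem_map_cons (T : eqType) (a b : T) (w : seq T) (s : seq (seq T)) :
  (b :: w \in map (cons a) s) = (b == a) && (w \in s).
Proof.
by apply/mapP/andP=> [[u su [-> ->]] | [/eqP-> sw]]; [| exists w].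
Qed.

Lemma mem_nonneg_paths (k x i : nat) (w : word) :
  (w \in nonneg_paths k x i) =
  [&& size w == k, count_mem false w == x & nonneg_from i w].
Proof.
elim: k x i w => [|k IHk] x i [|b w] /=.
- by rewrite andbT eq_sym; case: eqP.
- by case: eqP.
- rewrite mem_cat; apply/negP=> /orP[].
    by case: x => // x /mapP[].
  by case: i => // i /mapP[].
- rewrite mem_cat eqSS.
  case: x i b => [|x] [|i] [] /=; rewrite ?mem_map_cons ?IHk ?in_nil //=;
    by rewrite ?add0n ?add1n ?eqSS ?andbF ?orbF.
Qed.

Lemma uniq_nonneg_paths (k x i : nat) : uniq (nonneg_paths k x i).
Proof.
elim: k x i => [|k IHk] x i /=; first by case: ifP.
have cons_inj (b : bool) : injective (cons b) by move=> u v [].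
rewrite cat_uniq; apply/and3P; split.
- by case: x => // x; rewrite map_inj_uniq.
- apply/hasPn=> w; case: i => // i /mapP[u _ ->].
  by case: x => // x; rewrite mem_map_cons.
- by case: i => // i; rewrite map_inj_uniq.
Qed.

(* The hypothesis says that the end point [i + x - (k - x)] is at least -1. *)
Lemma size_nonneg_paths (k x i : nat) :
  k <= x.*2 + i.+1 ->
  size (nonneg_paths k x i) + 'C(k, x + i.+1) = 'C(k, x).
Proof.
elim: k x i => [|k IHk] x i le_k; first by case: x le_k => [|x]; rewrite ?bin0n.
rewrite [nonneg_paths _ _ _]/= size_cat.
case: x i le_k => [|x] [|i] le_k; rewrite ?size_map /= ?add0n.
- by have -> : k = 0 by lia.
- have := IHk 0 i; rewrite add0n binS !bin0 => <-; last by lia.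
  by rewrite (@bin_small k i.+2) //; lia.
(* From height 0 only an up step is possible, and Pascal's rule adds the same ['C(k, x.+1)] to both
   sides. *)
- have := IHk x 1; rewrite !addSn !addnS !addn0 !binS => IH.
  by lia.
- have := IHk x i.+2; have := IHk x.+1 i.
  by rewrite doubleS !addSn !addnS !binS => IH1 IH2; lia.
Qed.

(** * Binomial sums and Catalan numbers *)

Lemma hockey_stick (a b k : nat) :
  \sum_(0 <= y < k) 'C(a + y, b) + 'C(a, b.+1) = 'C(a + k, b.+1).
Proof.
elim: k => [|k IHk]; first by rewrite big_geq ?addn0.
by rewrite big_nat_recr //= addnS binS -IHk; lia.
Qed.

(** Hockey stick in [y], then in [x]; the successor accounts for the boundary term
    ['C(m.+1, m.+1)]. *)
Lemma sum_bin_square (m : nat) :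
  (\sum_(0 <= x < m.+1) \sum_(0 <= y < m.+1) 'C(x + y, x)).+1 =
  'C(m.+1.*2, m.+1).
Proof.
have -> : \sum_(0 <= x < m.+1) \sum_(0 <= y < m.+1) 'C(x + y, x) =
          \sum_(0 <= x < m.+1) 'C(m.+1 + x, m).
  apply: eq_bigr => x _.
  have := hockey_stick x x m.+1; rewrite bin_small // addn0 => ->.
  by rewrite -bin_sub; [congr 'C(_, _); lia | lia].
have := hockey_stick m.+1 m m.+1; rewrite binn addnn; lia.
Qed.

(** This totals the reflected paths. The boundary terms ['C(x, m.+2)] and ['C(m.+1, m.+3)]
    vanish. *)
Lemma sum_bin_square_above (m : nat) :
  \sum_(0 <= x < m.+1) \sum_(0 <= y < m.+1) 'C(x + y, m.+1) =
  'C(m.+1.*2, m.+3).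
Proof.
have -> : \sum_(0 <= x < m.+1) \sum_(0 <= y < m.+1) 'C(x + y, m.+1) =
          \sum_(0 <= x < m.+1) 'C(m.+1 + x, m.+2).
  apply: eq_big_nat => x /andP[_ le_x].
  have := hockey_stick x m.+1 m.+1; rewrite (@bin_small x) ?addn0; last by lia.
  by rewrite addnC.
have := hockey_stick m.+1 m.+2 m.+1.
by rewrite (@bin_small m.+1) // addn0 addnn.
Qed.

Lemma catalan_sub (n : nat) :
  catalan n.+1 + 'C(n.*2, n.+2) = 'C(n.*2, n).
Proof.
apply/eqP; rewrite -(@eqn_pmul2r n.+2) // mulnDl catalanE; apply/eqP.
have -> : 'C(n.+1.*2, n.+1) = ('C(n.*2, n) + 'C(n.*2, n.+1)).*2.
  have -> : ('C(n.*2, n) + 'C(n.*2, n.+1)) = 'C(n.*2.+1, n.+1).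
    by rewrite binS addnC.
  rewrite doubleS binS -[RHS]addnn; congr (_ + _).
  by rewrite -bin_sub; [congr binomial | ]; lia.
have := mul_bin_left n.*2 n; have := mul_bin_left n.*2 n.+1.
(* The two ratio identities reduce everything to ['C(n.*2, n)]; for [n = 0] the factor [n.*2 - n.+1]
   is truncated, hence the case split. *)
case: n => [|n] //; nia.
Qed.

(** * Enumeration by letter counts, and the final count *)

Definition low_cuts_words (m : nat) : seq word :=
  [seq w | p <- [seq (x, y) | x <- iota 0 m.+1, y <- iota 0 m.+1],
           w <- nonneg_paths (p.1 + p.2) p.1 (m - p.1)].

Lemma mem_low_cuts_words (m : nat) (v : word) :
  reflect (low_cuts m v) (v \in low_cuts_words m).
Proof.
apply: (equivP allpairsPdep); split=> [[p [w [/allpairsP[[x y]]]]] | low].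
  rewrite !mem_iota !add0n /= !ltnS mem_nonneg_paths => -[xm ym ->] /=.
  case/and3P=> /eqP size_w /eqP c0 nn ->; apply/low_cutsP.
  have := count_bool w; rewrite size_w c0 nn xm => /addnI->.
  by rewrite ym.
case/low_cutsP/and3P: low => c0 c1 nn.
exists (count_mem false v, count_mem true v), v; split=> //.
  by apply: allpairs_f; rewrite mem_iota ltnS.
by rewrite mem_nonneg_paths /= count_bool !eqxx.
Qed.

Lemma uniq_low_cuts_words (m : nat) : uniq (low_cuts_words m).
Proof.
apply: allpairs_uniq_dep.
- by apply: allpairs_uniq; rewrite ?iota_uniq // => -[? ?] [? ?] _ _.
- by move=> p _; apply: uniq_nonneg_paths.
- move=> u u' /allpairsPdep[[x y] [w [_ Pw ->]]].
  case/allpairsPdep=> [[x' y'] [w' [_ Pw' ->]]] /= Dw.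
  move: Pw Pw'; rewrite -{w'}Dw !mem_nonneg_paths /=.
  case/and3P=> /eqP sw /eqP cw _ /and3P[/eqP sw' /eqP cw' _].
  have xE : x = x' by rewrite -cw.
  have yE : y = y' by lia.
  by rewrite xE yE.
Qed.

Lemma size_low_cuts_words (m : nat) :
  size (low_cuts_words m) = catalan m.+2 - 1.
Proof.
suff : size (low_cuts_words m) + 'C(m.+1.*2, m.+3) + 1 = 'C(m.+1.*2, m.+1).
  by have := catalan_sub m.+1; lia.
rewrite -sum_bin_square addn1 -sum_bin_square_above; congr _.+1.
rewrite size_allpairs_dep sumnE big_map big_allpairs -!/(index_iota 0 m.+1).
rewrite -big_split; apply: eq_big_nat => x /andP[_ le_x].
rewrite -big_split; apply: eq_big_nat => y /andP[_ le_y].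
(* Starting at height [m - x] makes the lower index of the reflected binomial equal to [m.+1] for
   every [x]. *)
rewrite -(@size_nonneg_paths (x + y) x (m - x)) /=; last by lia.
by have -> : x + (m - x).+1 = m.+1 by lia.
Qed.

Lemma card_eq_size (T : eqType) (s : seq T) :
  uniq s -> [set x : T | x \in s] #= `I_(size s).
Proof.
move=> s_uniq; apply/card_set_bijP; exists (index^~ s); split.
- by move=> x /=; rewrite index_mem.
- move=> x y /set_mem /= sx /set_mem /= sy Dxy.
  by rewrite -(nth_index x sx) Dxy nth_index.
- case: s s_uniq => [|x0 s] s_uniq i lt_i //.
  by exists (nth x0 (x0 :: s) i); [exact: mem_nth | exact: (@index_uniq _ x0 i (x0 :: s))].
Qed.

Theorem theorem4p9 (n : nat) (hn : 1 <= n) :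
  [set w : word | trimmed_dyck n w] #= `I_(catalan n.+1 - 1).
Proof.
case: n hn => // n _.
pose frame (v : word) := false :: rcons v true.
have frame_inj : injective frame by move=> u v [] /rcons_inj[].
have frameP w : trimmed_dyck n.+1 w <-> w \in map frame (low_cuts_words n).
  split=> [/trimmed_dyck_low_cuts[v -> /mem_low_cuts_words] | /mapP[v]].
    exact: map_f.
  by move=> /mem_low_cuts_words low ->; apply: low_cuts_trimmed_dyck.
have -> : [set w | trimmed_dyck n.+1 w] =
          [set w | w \in map frame (low_cuts_words n)].
  by apply/seteqP; split=> w /frameP.
rewrite -size_low_cuts_words -(size_map frame); apply: card_eq_size.
by rewrite map_inj_uniq ?uniq_low_cuts_words.
Qed.
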